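(* Let $G_1$ and $G_2$ be graphs with disjoint vertex sets. Then $\mathrm{indthin}(G_1\vee G_2)=\mathrm{indthin}(G_1)+\mathrm{indthin}(G_2)$ and $\mathrm{indpthin}(G_1\vee G_2)=\mathrm{indpthin}(G_1)+\mathrm{indpthin}(G_2)$.
   Context: Graphs are finite, simple, undirected. The join $G_1\vee G_2$ has vertex set $V_1\cup V_2$ and edge set $E_1\cup E_2\cup\{vv': v\in V_1, v'\in V_2\}$. For a graph $G=(V,E)$, an ordering $v_1,\dots,v_n$ of $V$ and a partition of $V$ are consistent if for every $r<s<t$, whenever $v_r,v_s$ are in the same class and $v_tv_r\in E$, then $v_tv_s\in E$; they are strongly consistent if moreover for every $r<s<t$, whenever $v_s,v_t$ are in the same class and $v_tv_r\in E$, then $v_sv_r\in E$. $\mathrm{indthin}(G)$ is the minimum $k$ such that some ordering of $V$ and some partition of $V$ into $k$ independent sets are consistent; $\mathrm{indpthin}(G)$ is defined likewise with strongly consistent. *)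

(* Defs.v *)
From HB Require Import structures.
From mathcomp Require Import all_boot.
Set Implicit Arguments.
Unset Strict Implicit.
Unset Printing Implicit Defensive.

Record sgraph := SGraph {
  vertex :> finType;
  adj : rel vertex;
  adj_sym : symmetric adj;
  adj_irrefl : irreflexive adj }.

Section Join.
Variables G1 G2 : sgraph.

Definition join_adj : rel (G1 + G2)%type := fun x y =>
  match x, y with
  | inl u, inl v => adj u v
  | inr u, inr v => adj u v
  | _, _ => true
  end.

Lemma join_adj_sym : symmetric join_adj.
Proof. by move=> [u|u] [v|v] //=; apply: adj_sym. Qed.

Lemma join_adj_irrefl : irreflexive join_adj.
Proof. by move=> [u|u] /=; apply: adj_irrefl. Qed.

(* The sum type makes the two vertex sets disjoint. *)
Definition join : sgraph := SGraph join_adj_sym join_adj_irrefl.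
End Join.

Section Thinness.
Variable G : sgraph.

Definition same_class (P : {set {set G}}) (x y : G) : bool :=
  [exists C in P, (x \in C) && (y \in C)].

Definition independent (C : {set G}) : bool :=
  [forall x in C, forall y in C, ~~ adj x y].

(* An injection from 'I_#|G| to G is a bijection, i.e. v_1, ..., v_n lists
   every vertex exactly once. *)
Definition ordering (v : {ffun 'I_#|G| -> G}) : bool := injectiveb v.

Definition consistent (v : {ffun 'I_#|G| -> G}) (P : {set {set G}}) : bool :=
  [forall r : 'I_#|G|, forall s : 'I_#|G|, forall t : 'I_#|G|,
    [&& r < s, s < t, same_class P (v r) (v s) & adj (v t) (v r)]
      ==> adj (v t) (v s)].

Definition strongly_consistent (v : {ffun 'I_#|G| -> G}) (P : {set {set G}})
    : bool :=
  consistent v P &&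
  [forall r : 'I_#|G|, forall s : 'I_#|G|, forall t : 'I_#|G|,
    [&& r < s, s < t, same_class P (v s) (v t) & adj (v t) (v r)]
      ==> adj (v s) (v r)].

Definition indep_partition (P : {set {set G}}) (k : nat) : bool :=
  [&& partition P [set: G], #|P| == k & [forall C in P, independent C]].

Definition indthin_witness (k : nat) : bool :=
  [exists v : {ffun 'I_#|G| -> G}, exists P : {set {set G}},
    [&& ordering v, indep_partition P k & consistent v P]].

Definition indpthin_witness (k : nat) : bool :=
  [exists v : {ffun 'I_#|G| -> G}, exists P : {set {set G}},
    [&& ordering v, indep_partition P k & strongly_consistent v P]].

Lemma ex_indpthin : exists k, indpthin_witness k.
Proof.
pose P := [set [set x] | x in [set: G]].
pose v : {ffun 'I_#|G| -> G} := [ffun i => enum_val i].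
have sameE x y : same_class P x y -> x = y.
  by case/existsP=> C /andP[/imsetP[z _ ->]]; rewrite !inE => /andP[/eqP-> /eqP->].
have vinj : injective v by move=> i j; rewrite !ffunE; apply: enum_val_inj.
exists #|P|; apply/existsP; exists v; apply/existsP; exists P.
apply/and3P; split; first exact/injectiveP.
- apply/and3P; split=> //.
    apply/and3P; split.
    + apply/eqP/setP=> x; rewrite inE; apply/bigcupP; exists [set x].
        by apply/imsetP; exists x; rewrite ?inE.
      by rewrite inE.
    + apply/trivIsetP=> _ _ /imsetP[x _ ->] /imsetP[y _ ->] nxy.
      by rewrite disjoints1 inE; apply: contra nxy => /eqP->.
    + by apply/imsetP=> -[x _] /setP/(_ x); rewrite !inE eqxx.
  apply/forall_inP=> _ /imsetP[x _ ->].
  apply/forall_inP=> y /set1P->; apply/forall_inP=> z /set1P->.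
  by rewrite adj_irrefl.
- apply/andP; split; apply/forallP=> r; apply/forallP=> s; apply/forallP=> t.
    by apply/implyP=> /and4P[_ _ /sameE->].
  by apply/implyP=> /and4P[_ _ /sameE->].
Qed.

Lemma ex_indthin : exists k, indthin_witness k.
Proof.
have [k /existsP[v /existsP[P /and3P[ov iP /andP[cv _]]]]] := ex_indpthin.
by exists k; apply/existsP; exists v; apply/existsP; exists P; apply/and3P.
Qed.

Definition indthin : nat := ex_minn ex_indthin.
Definition indpthin : nat := ex_minn ex_indpthin.
End Thinness.

(* Main.v *)
Require Import Defs.
From mathcomp Require Import all_boot.

(** An ordering with a consistent partition into independent sets amounts to an
    injective position function together with a colouring whose fibres are the
    classes. Such layouts of G1 and G2 combine by placing all of G1 before all
    of G2 and using disjoint palettes: a vertex of one side is adjacent to the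
    whole other side, so no mixed triple violates consistency. Conversely a
    layout of the join restricts to both sides, and the two sides use disjoint
    palettes because vertices of opposite sides are adjacent. *)

(** Positions are arbitrary natural numbers, gaps allowed, so that a layout restricts to a side of a
    join without renumbering. The flag [strong] lets one argument serve both equalities. *)
Definition layout (strong : bool) (G : sgraph) (T : Type)
    (pos : G -> nat) (c : G -> T) : Prop :=
  [/\ injective pos,
      forall x y : G, c x = c y -> ~~ adj x y,
      forall x y z : G, pos x < pos y -> pos y < pos z -> c x = c y ->
        adj z x -> adj z y
    & strong -> forall x y z : G, pos x < pos y -> pos y < pos z ->
        c y = c z -> adj z x -> adj y x].

Definition thin (strong : bool) (G : sgraph) : nat :=
  if strong then indpthin G else indthin G.

Definition valid_thin_witness (strong : bool) (G : sgraph)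
    (v : {ffun 'I_#|G| -> G}) (P : {set {set G}}) (k : nat) : Prop :=
  [/\ ordering v, indep_partition P k
    & (if strong then strongly_consistent v P else consistent v P)].

Lemma thin_witness strong (G : sgraph) :
  exists v P, valid_thin_witness strong G v P (thin strong G).
Proof.
by case: strong; rewrite /thin /indthin /indpthin; case: ex_minnP => k;
   move=> /existsP[v /existsP[P /and3P[? ? ?]]] _; exists v, P.
Qed.

Lemma thin_min strong (G : sgraph) v P k :
  valid_thin_witness strong G v P k -> thin strong G <= k.
Proof.
case: strong => -[ov iP cP]; rewrite /thin /indthin /indpthin;
  case: ex_minnP => m _; apply;
  by apply/existsP; exists v; apply/existsP; exists P; apply/and3P.
Qed.

Lemma same_class_pblock {G : sgraph} {P : {set {set G}}} (x y : G) :
  partition P [set: G] -> pblock P x = pblock P y -> same_class P x y.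
Proof.
case/and3P=> /eqP covP tP _ exy; apply/existsP; exists (pblock P x).
by rewrite pblock_mem ?covP ?inE // mem_pblock exy mem_pblock covP !inE.
Qed.

(** Inverting the ordering gives the positions, and the colour of a vertex is its block. The bound
    on [pos] later serves to shift one layout past another. *)
Lemma thin_layout strong (G : sgraph) :
  exists (T : finType) (pos : G -> nat) (c : G -> T),
    [/\ layout strong G T pos c, forall x, pos x < #|G|
      & #|c @: [set: G]| <= thin strong G].
Proof.
have [v [P [/injectiveP vinj /and3P[pP /eqP <- /forall_inP indP] conP]]] :=
  thin_witness strong G.
have [g gK vK] : bijective v by apply: inj_card_bij => //; rewrite card_ord.
exists {set G}, (fun x => nat_of_ord (g x)), (pblock P).
split=> [|x|]; last 2 first.
- exact: ltn_ord.
- apply/subset_leq_card/subsetP=> _ /imsetP[x _ ->].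
  by case/and3P: pP => /eqP covP _ _; rewrite pblock_mem ?covP.
have con : consistent v P by case: (strong) conP => // /andP[].
split=> [x y /val_inj/(can_inj vK) //|x y|x y z ltxy ltyz exy zx|].
- case/(same_class_pblock _ _ pP)/existsP=> C /and3P[/indP/forall_inP iC xC yC].
  by move/iC/forall_inP: xC; apply.
- move/forallP/(_ (g x))/forallP/(_ (g y))/forallP/(_ (g z))/implyP: con.
  by rewrite !vK; apply; rewrite ltxy ltyz zx same_class_pblock.
- move=> st x y z ltxy ltyz eyz zx; move: conP; rewrite st => /andP[_].
  move/forallP/(_ (g x))/forallP/(_ (g y))/forallP/(_ (g z))/implyP.
  by rewrite !vK; apply; rewrite ltxy ltyz zx same_class_pblock.
Qed.

(** Sorting the vertices by [pos] closes the gaps between positions. *)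
Lemma ordering_of_pos {G : sgraph} (pos : G -> nat) :
  injective pos ->
  exists2 v : {ffun 'I_#|G| -> G}, ordering v
    & forall i j : 'I_#|G|, i < j -> pos (v i) < pos (v j).
Proof.
move=> posI; pose e x y := pos x <= pos y; pose s := sort e (enum G).
have size_s : size s = #|G| by rewrite size_sort cardE.
have s_uniq : uniq s by rewrite sort_uniq enum_uniq.
have s_sorted : sorted e s by apply: sort_sorted => x y; apply: leq_total.
(* [G] may be empty, so the default vertex is drawn from the index [i] itself; defaults for
   different indices are reconciled below. *)
exists [ffun i => nth (enum_val i) s i].
  apply/injectiveP=> i j; rewrite !ffunE => eij; apply/val_inj/eqP.
  rewrite -(nth_uniq (enum_val i) _ _ s_uniq) ?size_s ?ltn_ord //.
  by rewrite eij (set_nth_default (enum_val i) (enum_val j)) ?size_s.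
move=> i j ltij; rewrite !ffunE (set_nth_default (enum_val i) (enum_val j)) ?size_s //.
(* Sortedness yields only a weak inequality; strictness comes from injectivity of [pos] and
   [s_uniq]. *)
rewrite ltn_neqAle (inj_eq posI) nth_uniq ?size_s ?ltn_ord // (ltn_eqF ltij).
apply: (sorted_leq_nth (leT := e)); rewrite ?inE ?size_s //.
- by move=> y x z; apply: leq_trans.
- by move=> x; apply: leqnn.
- exact: ltnW.
Qed.

(** The nonempty fibres of [c] are the classes. Counting attained colours rather than all of [T]
    matters when two sides share a palette. *)
Lemma layout_thin_le strong (G : sgraph) (T : finType) (pos : G -> nat)
    (c : G -> T) :
  layout strong G T pos c -> thin strong G <= #|c @: [set: G]|.
Proof.
case=> posI ind con scon; have [v ov vpos] := ordering_of_pos pos posI.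
pose P := preim_partition c [set: G].
have pP : partition P [set: G] := preim_partitionP _ _.
have sameE x y : same_class P x y -> c x = c y.
  case/existsP=> C /and3P[/imsetP[z _ ->]].
  by rewrite !inE => /eqP<- /eqP<-.
have leP : #|P| <= #|c @: [set: G]|.
  have -> : P = [set [set y | a == c y] | a in c @: [set: G]].
    rewrite -imset_comp; apply: eq_imset => x /=.
    by apply/setP=> y; rewrite !inE.
  exact: leq_imset_card.
apply: leq_trans leP; apply: (thin_min strong G v P); split=> //.
  rewrite /indep_partition pP eqxx; apply/forall_inP=> C PC.
  apply/forall_inP=> x xC; apply/forall_inP=> y yC.
  by apply/ind/sameE/existsP; exists C; rewrite PC xC.
have conP : consistent v P.
  apply/forallP=> r; apply/forallP=> s; apply/forallP=> t.
  apply/implyP=> /and4P[/vpos rs /vpos st /sameE]; exact: con rs st.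
case: strong scon => // /(_ isT) scon; rewrite /strongly_consistent conP.
apply/forallP=> r; apply/forallP=> s; apply/forallP=> t.
apply/implyP=> /and4P[/vpos rs /vpos st /sameE]; exact: scon rs st.
Qed.

Lemma thin_join_le strong (G1 G2 : sgraph) :
  thin strong (join G1 G2) <= thin strong G1 + thin strong G2.
Proof.
have [T1 [p1 [c1 [[inj1 ind1 con1 scon1] b1 le1]]]] := thin_layout strong G1.
have [T2 [p2 [c2 [[inj2 ind2 con2 scon2] _ le2]]]] := thin_layout strong G2.
(* By [b1] the offset [#|G1|] exceeds every [p1 u]. *)
pose pos (x : join G1 G2) :=
  match x with inl u => p1 u | inr u => #|G1| + p2 u end.
pose c (x : join G1 G2) : T1 + T2 :=
  match x with inl u => inl (c1 u) | inr u => inr (c2 u) end.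
have lt12 u w : #|G1| + p2 w < p1 u = false.
  by apply/negbTE; rewrite -leqNgt (leq_trans (ltnW (b1 u))) ?leq_addr.
have L : layout strong (join G1 G2) (T1 + T2)%type pos c.
  (* Equal colours force equal sides, and cross adjacencies compute to [true]; beyond the one-sided
     cases, only injectivity across sides remains. *)
  split=> [[x|x] [y|y]|[x|x] [y|y]|[x|x] [y|y] [z|z]|st [x|x] [y|y] [z|z]] //=;
    rewrite ?ltn_add2l ?lt12 //.
  - by move/inj1->.
  - by move=> e; have := b1 x; rewrite e ltnNge leq_addr.
  - by move=> e; have := b1 y; rewrite -e ltnNge leq_addr.
  - by move/addnI/inj2->.
  - by case=> /ind1.
  - by case=> /ind2.
  - by move=> xy yz [e]; apply: con1 xy yz e.
  - by move=> xy yz [e]; apply: con2 xy yz e.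
  - by move=> xy yz [e]; apply: (scon1 st _ _ _ xy yz e).
  - by move=> xy yz [e]; apply: (scon2 st _ _ _ xy yz e).
apply: leq_trans (layout_thin_le _ _ _ _ _ L) _.
apply: leq_trans (leq_add le1 le2).
rewrite -(card_imset _ (@inl_inj T1 T2)) -(card_imset (c2 @: _) (@inr_inj T1 T2)).
apply: leq_trans (leq_card_setU _ _); apply/subset_leq_card/subsetP.
by move=> _ /imsetP[[u|u] _ ->] /=; rewrite inE !imset_f ?orbT ?inE.
Qed.

Lemma thin_join_ge strong (G1 G2 : sgraph) :
  thin strong G1 + thin strong G2 <= thin strong (join G1 G2).
Proof.
have [T [pos [c [[inj ind con scon] _ le]]]] := thin_layout strong (join G1 G2).
have L1 : layout strong G1 T (fun u => pos (inl u)) (fun u => c (inl u)).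
  split=> [x y /inj[] //|x y /ind //|x y z|st x y z].
  - exact: (con (inl x) (inl y) (inl z)).
  - exact: (scon st (inl x) (inl y) (inl z)).
have L2 : layout strong G2 T (fun u => pos (inr u)) (fun u => c (inr u)).
  split=> [x y /inj[] //|x y /ind //|x y z|st x y z].
  - exact: (con (inr x) (inr y) (inr z)).
  - exact: (scon st (inr x) (inr y) (inr z)).
apply: leq_trans le; apply: leq_trans (leq_add (layout_thin_le _ _ _ _ _ L1)
  (layout_thin_le _ _ _ _ _ L2)) _.
set A := imset _ _; set B := imset _ _.
have AB : [disjoint A & B].
  rewrite disjoint_subset; apply/subsetP=> _ /imsetP[x _ ->].
  (* A shared colour would make [inl x] and [inr y] nonadjacent in the join. *)
  by rewrite !inE; apply/imsetP=> -[y _ /ind].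
(* Disjointness is exactly the equality case of the union bound. *)
have /eqP <- : #|A :|: B| == #|A| + #|B| by rewrite leq_card_setU.
apply/subset_leq_card/subsetP=> t; rewrite inE.
by case/orP=> /imsetP[x _ ->]; rewrite imset_f ?inE.
Qed.

Theorem theorem4p11 (G1 G2 : sgraph) :
  indthin (join G1 G2) = indthin G1 + indthin G2 /\
  indpthin (join G1 G2) = indpthin G1 + indpthin G2.
Proof.
have H strong : thin strong (join G1 G2) = thin strong G1 + thin strong G2.
  by apply/eqP; rewrite eqn_leq thin_join_le thin_join_ge.
by split; [apply: (H false) | apply: (H true)].
Qed.
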